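(* Let $\varepsilon>0$. Then there exists $C_0$ such that for every $C\ge C_0$ the following holds. Let $P$ be a path with $d\ge C$ edges. For any graph $G$ with $e(G)\ge\varepsilon d|G|$ that contains no copy of $P$, it is possible to delete at most $\varepsilon e(G)$ edges from $G$ to obtain a graph $H$ each of whose connected components has a cover of order at most $Cd$.
   Context: $|G|$ denotes the number of vertices and $e(G)$ the number of edges of $G$. A copy of $P$ in $G$ is a subgraph isomorphic to $P$. A cover of a graph $F$ is a set $S\subseteq V(F)$ such that every edge of $F$ has at least one endpoint in $S$. *)

(* Defs.v *)
From HB Require Import structures.
From mathcomp Require Import all_boot all_order all_algebra.
From mathcomp Require Import reals.
Set Implicit Arguments. Unset Strict Implicit. Unset Printing Implicit Defensive.

(* A finite simple graph on vertex type T (V(G) = T, |G| = #|T|) is given by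
   its edge set E : {set {set T}}, every edge being a 2-element set.
   e(G) = #|E|. *)
Definition simple_graph (T : finType) (E : {set {set T}}) : Prop :=
  forall e, e \in E -> #|e| = 2.

Definition adj (T : finType) (E : {set {set T}}) : rel T :=
  fun x y => [set x; y] \in E.

Definition has_path (T : finType) (E : {set {set T}}) (d : nat) : Prop :=
  exists (x : T) (s : seq T), [/\ size s = d, uniq (x :: s) & path (adj E) x s].

Definition component (T : finType) (E : {set {set T}}) (x : T) : {set T} :=
  [set y | connect (adj E) x y].

Definition is_cover (T : finType) (E : {set {set T}}) (K S : {set T}) : Prop :=
  S \subset K /\ forall e, e \in E -> e \subset K -> e :&: S != set0.

(* Main.v *)
Require Import Defs.
From HB Require Import structures.
From mathcomp Require Import all_boot all_order all_algebra.
From mathcomp Require Import boolp reals.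
From mathcomp Require Import zify lra.
Set Implicit Arguments. Unset Strict Implicit. Unset Printing Implicit Defensive.

(** Put N ~ 4 / eps^2, k = d / N, K = 4 N. Among the nonempty vertex sets with at
most K outer neighbours take an inclusion-minimal one X, and let P be a longest path
in the graph induced on X and its neighbours, so that P has at most d vertices.
Deleting the at most K |X| edges that leave X and the edges of X avoiding P makes P
a cover of X, and one continues with the graph outside X. The point is that X \ P
spans at most k |X| edges: otherwise it contains a cycle of length > k. Enlarge
the cycle off P by ears until none is left; any two of its vertices remain
joined by a path of length k / 2 inside it. Cut P into 2 N intervals of about
k / 2 vertices. Two disjoint connections from the enlarged cycle to the same interval
would give a longer path. So one vertex per interval suffices to meet all the
connections, and these 2 N vertices separate the cycle from P; by submodularity of
the neighbourhood size one side of this separation contradicts the minimality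
of X. *)

(** * Paths, longest paths and shortcuts between their vertices *)

Section Paths.
Variables (T : finType) (e : rel T).
Hypotheses (e_sym : symmetric e) (e_irr : irreflexive e).

(** The start [x] is kept apart, so [size p] counts edges and the path has [(size p).+1]
    vertices. *)
Definition upath (A : {set T}) (x : T) (p : seq T) : bool :=
  [&& path e x p, uniq (x :: p) & all [in A] (x :: p)].

Definition longest (A : {set T}) (x : T) (p : seq T) : Prop :=
  upath A x p /\ forall y q, upath A y q -> size q <= size p.

(** This abstracts the property of a cycle of length at least [2L] that survives the addition of
    ears. *)
Definition long_linked (L : nat) (Q : {set T}) : Prop :=
  forall x y, x \in Q -> y \in Q -> x != y ->
  exists p, [/\ upath Q x p, last x p = y & L <= size p].

Lemma path_sym_rev x p y :
  path e x (rcons p y) = path e y (rcons (rev p) x).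
Proof.
have := rev_path e x (rcons p y).
rewrite last_rcons belast_rcons rev_cons => ->.
by apply: eq_path => u v; rewrite /= e_sym.
Qed.

Lemma upath_rev (A : {set T}) x p : upath A x p ->
  exists p', [/\ upath A (last x p) p', last (last x p) p' = x & size p' = size p].
Proof.
case/lastP: p => [|p y]; first by exists [::].
rewrite last_rcons => /and3P[xp up Ap]; exists (rcons (rev p) x).
split; rewrite ?last_rcons ?size_rcons ?size_rev //.
have ev : y :: rcons (rev p) x = rev (x :: rcons p y).
  by rewrite rev_cons rev_rcons.
by rewrite /upath -path_sym_rev xp ev rev_uniq up all_rev Ap.
Qed.

Lemma upath_sub (A B : {set T}) x p : A \subset B -> upath A x p -> upath B x p.
Proof.
move=> /subsetP AB /and3P[xp up Ap]; apply/and3P; split=> //.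
by apply: sub_all Ap => y /AB.
Qed.

Lemma longest_exists (A : {set T}) x0 : x0 \in A -> exists x p, longest A x p.
Proof.
move=> Ax0; pose S n := `[< exists x p, upath A x p /\ size p = n >].
have S0 : exists n, S n.
  by exists 0; apply/asboolP; exists x0, [::]; rewrite /upath /= Ax0.
have Sb n : S n -> n <= #|T|.
  move=> /asboolP[x [p [/and3P[_ up _] <-]]].
  by move: (max_card [in x :: p]); rewrite (card_uniqP up) => /ltnW.
case: (ex_maxnP S0 Sb) => n /asboolP[x [p [xp <-]]] nmax.
exists x, p; split=> // y q yq; apply: nmax; apply/asboolP.
by exists y, q.
Qed.

(** Replacing the segment of [p] between [a] and [b] by [r] gives another path in [W], so [r] has at
    most as many vertices as the interior of that segment. *)
Lemma detour_short (W : {set T}) x p a b r : longest W x p ->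
  a \in x :: p -> b \in x :: p -> index a (x :: p) < index b (x :: p) ->
  path e a (rcons r b) -> uniq r -> {subset r <= W} ->
  (forall v, v \in r -> v \notin x :: p) ->
  size r < index b (x :: p) - index a (x :: p).
Proof.
move=> [/and3P[xp up Wp] pmax] ap bp lt_ab ar ur rW rp.
have [p1 [p2 E]] : exists p1 p2, x :: p = p1 ++ a :: p2.
  by case/splitPr: ap => p1 p2; exists p1, p2.
have ap1 : a \notin p1.
  by move: up; rewrite E cat_uniq /= negb_or => /and3P[_ /andP[]].
have ia : index a (x :: p) = size p1.
  by rewrite E index_cat (negPf ap1) /= eqxx addn0.
have bp1 : b \notin p1.
  apply: contraL lt_ab => bp1; rewrite -leqNgt ia E index_cat bp1.
  by rewrite ltnW // index_mem.
have ba : a != b by apply: contraTneq lt_ab => ->; rewrite ltnn.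
have [p3 [p4 E2]] : exists p3 p4, p2 = p3 ++ b :: p4.
  have : b \in p2 by move: bp; rewrite E mem_cat inE (negPf bp1) eq_sym (negPf ba).
  by case/splitPr => p3 p4; exists p3, p4.
rewrite E2 in E.
have bp3 : b \notin p3.
  by move: up; rewrite E -cat_rcons cat_uniq cat_uniq /= => /and5P[_ _ _ /norP[]].
have ib : index b (x :: p) = (size p1 + (size p3).+1)%N.
  by rewrite E index_cat (negPf bp1) /= (negPf ba) index_cat (negPf bp3) /= eqxx addn0.
have es : sorted e (p1 ++ a :: r ++ b :: p4).
  move: xp; rewrite -[path e x p]/(sorted e (x :: p)) E.
  rewrite !sorted_cat_cons -!cat_rcons !cat_path !last_rcons ar.
  by case/and3P=> -> _ ->.
have us : uniq (p1 ++ a :: r ++ b :: p4).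
  move: up; rewrite E -(cat_rcons a) uniq_catCA cat_uniq => /and3P[_ _ u'].
  rewrite -(cat_rcons a) uniq_catCA cat_uniq ur u' andbT /=.
  apply/hasPn => v v'; apply: contraL v' => /rp; apply: contra.
  by rewrite E !(mem_cat, mem_rcons, inE) => /or3P[/orP[]||] ->; rewrite ?orbT.
have As : all [in W] (p1 ++ a :: r ++ b :: p4).
  move: Wp; rewrite E !(all_cat, all_rcons) /= !all_cat /=.
  case/and4P=> -> -> _ -> /=; rewrite andbT.
  by apply/allP => v /rW.
case Es: (p1 ++ a :: r ++ b :: p4) => [|y q].
  by case: (p1) Es.
have /pmax : upath W y q by apply/and3P; rewrite -Es; split=> //; move: es; rewrite Es.
rewrite ia ib; move: (congr1 size Es) (congr1 size E).
rewrite /= !size_cat /= !size_cat /=; clear.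
by lia.
Qed.

(** * Long-linked sets: ears, cycles and minimum degree *)

Lemma join_legs L (Q : {set T}) a b s t : long_linked L Q ->
  a \in Q -> b \in Q -> a != b -> path e a s -> path e b t ->
  uniq (s ++ t) -> (forall v, v \in s ++ t -> v \notin Q) ->
  exists p, [/\ L <= size p, last a p = b, {subset p <= Q},
    sorted e (rev s ++ a :: p ++ t) & uniq (rev s ++ a :: p ++ t)].
Proof.
move=> QL Qa Qb ab as_ bt ust stQ.
have [p [/and3P[ap up /allP Qp] pb pL]] := QL _ _ Qa Qb ab.
exists p; split=> //.
- by move=> v vp; apply: Qp; rewrite inE vp orbT.
- rewrite sorted_cat_cons cat_path pb ap bt !andbT.
  case/lastP: s as_ {ust stQ} => [|s z] // as_.
  by rewrite rev_rcons /= -path_sym_rev.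
rewrite -cat_cons uniq_catCA cat_uniq up /= cat_uniq rev_uniq.
rewrite (eq_has (mem_rev s)) -cat_uniq ust andbT.
apply/hasPn => v; rewrite mem_cat mem_rev -mem_cat => /stQ.
by apply: contra => /Qp.
Qed.

(** Two distinct vertices of the enlarged set run along disjoint, possibly empty, pieces of the ear
    to distinct vertices of [Q]; the long path inside [Q] then joins these. *)
Lemma long_linked_ear L (Q : {set T}) q q' r : long_linked L Q ->
  q \in Q -> q' \in Q -> q != q' -> path e q (rcons r q') -> uniq r ->
  (forall v, v \in r -> v \notin Q) -> long_linked L (Q :|: [set v in r]).
Proof.
move=> QL Qq Qq' qq' qr ur rQ.
pose legs x y := exists a b s t, [/\ [&& a \in Q, b \in Q & a != b],
  path e a s && path e b t, uniq (s ++ t), {subset s ++ t <= r} &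
  last a s = x /\ last b t = y].
have legsC x y : legs x y -> legs y x.
  case=> a [b [s [t [/and3P[Qa Qb ab] /andP[as_ bt] ust str [sx ty]]]]].
  exists b, a, t, s; split=> //; first by rewrite Qa Qb eq_sym ab.
  - by rewrite as_ bt.
  - by rewrite uniq_catC.
  - by move=> v; rewrite mem_cat orbC -mem_cat => /str.
have legl r1 x r2 : r = r1 ++ x :: r2 -> path e q (rcons r1 x).
  by move=> Er; move: qr; rewrite Er rcons_cat rcons_cons -cat_rcons cat_path => /andP[].
have legr r1 x r2 : r = r1 ++ x :: r2 -> path e q' (rcons (rev r2) x).
  move=> Er; move: qr; rewrite Er rcons_cat rcons_cons cat_path /= => /and3P[_ _].
  by rewrite path_sym_rev.
have legs_rQ x y : x \in r -> y \in Q -> legs x y.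
  move=> xr Qy; have [r1 [r2 Er]] : exists r1 r2, r = r1 ++ x :: r2.
    by case/splitPr: xr => r1 r2; exists r1, r2.
  (* The leg from [x] must end at a vertex other than [y]: it goes to [q'] if [y] is [q], and to [q]
     otherwise. *)
  have [yq|yq] := eqVneq y q.
    exists q', y, (rcons (rev r2) x), [::]; rewrite cats0 last_rcons.
    split; rewrite ?andbT //; first by rewrite Qq' Qy yq eq_sym.
    - exact: legr Er.
    - rewrite -rev_cons rev_uniq; move: ur.
      by rewrite Er cat_uniq => /and3P[].
    - by move=> v; rewrite -rev_cons mem_rev Er mem_cat => ->; rewrite orbT.
  exists q, y, (rcons r1 x), [::]; rewrite cats0 last_rcons.
  split; rewrite ?andbT //; first by rewrite Qq Qy eq_sym.
  - exact: legl Er.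
  - by move: ur; rewrite Er -cat_rcons cat_uniq => /andP[].
  - by move=> v; rewrite Er -cat_rcons mem_cat => ->.
have legs_rr r1 x r2 y r3 : r = r1 ++ x :: r2 ++ y :: r3 -> legs x y.
  move=> Er; have Er' : r = (r1 ++ x :: r2) ++ y :: r3 by rewrite Er -catA.
  exists q, q', (rcons r1 x), (rcons (rev r3) y).
  rewrite !last_rcons Qq Qq' qq' (legl _ _ _ Er) (legr _ _ _ Er'); split=> //.
  - rewrite -rev_cons cat_uniq rev_uniq has_rev -cat_uniq.
    by move: ur; rewrite Er -cat_rcons uniq_catCA cat_uniq => /and3P[].
  - move=> v; rewrite -rev_cons mem_cat mem_rev Er -cat_rcons !mem_cat.
    by case/orP=> ->; rewrite ?orbT.
have legsP x y : x \in Q :|: [set v in r] -> y \in Q :|: [set v in r] ->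
    x != y -> legs x y.
  rewrite !inE => /orP[xQ|xr] /orP[yQ|yr] xy.
  - by exists x, y, [::], [::]; rewrite xQ yQ xy.
  - exact/legsC/legs_rQ.
  - exact: legs_rQ.
  case/splitPr Er: {-}r / xr => [r1 r2].
  move: yr; rewrite {1}Er mem_cat inE eq_sym (negPf xy) /=.
  case/orP=> [yr|yr].
    apply: legsC; case/splitPr: yr Er => s1 s2 Er.
    by apply: (legs_rr s1 y s2 x r2); rewrite Er -catA.
  by case/splitPr: yr Er => s1 s2 /legs_rr.
move=> x y Qx Qy /(legsP _ _ Qx Qy)[a [b [s [t]]]].
case=> /and3P[Qa Qb ab] /andP[as_ bt] ust str [<- <-].
have [|p [pL pb pQ eF uF]] := join_legs QL Qa Qb ab as_ bt ust.
  by move=> v /str/rQ.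
have EF : rev s ++ a :: p ++ t = last a s :: behead (rev s ++ a :: p ++ t).
  by case/lastP: s {as_ ust str eF uF} => [|s z] //; rewrite rev_rcons last_rcons.
exists (behead (rev s ++ a :: p ++ t)); split.
- apply/and3P; rewrite -EF; split=> //; first by move: eF; rewrite {1}EF.
  apply/allP => v; rewrite mem_cat mem_rev inE mem_cat => vF.
  have [vst|] := boolP (v \in s ++ t).
    by rewrite !inE (str _ vst) orbT.
  rewrite mem_cat => /norP[/negPf vs /negPf vt]; move: vF; rewrite vs vt orbF /=.
  by rewrite !inE => /orP[/eqP->|/pQ->]; rewrite ?Qa.
- by move: (congr1 (last a) EF); rewrite last_cat /= last_cat pb => ->.
- rewrite size_behead size_cat /= size_cat addnS /=.
  exact: leq_trans pL (leq_trans (leq_addr _ _) (leq_addl _ _)).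
Qed.

(** Two vertices cut the cycle into two arcs with [size c] edges in total, so one arc has at least
    [L]. The second arc is traversed backwards. *)
Lemma cycle_long_linked L (c : seq T) :
  cycle e c -> uniq c -> L.*2 <= size c -> long_linked L [set v in c].
Proof.
move=> cc uc cL a b; rewrite !inE => ac bc ab.
have [i c' Ec] := rot_to ac.
have ec : cycle e (a :: c') by rewrite -Ec rot_cycle.
have u' : uniq (a :: c') by rewrite -Ec rot_uniq.
have s' : size c = (size c').+1 by rewrite -(size_rot i c) Ec.
have Q' : [set v in c] = [set v in a :: c'].
  by apply/setP => v; rewrite !inE -(mem_rot i c) Ec.
have bc' : b \in c' by move: bc; rewrite -(mem_rot i c) Ec inE eq_sym (negPf ab).
rewrite Q'; case/splitPr: bc' ec u' s' {Ec Q'} => c1 c2 /= ec u'.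
move: ec; rewrite rcons_cat rcons_cons -cat_rcons cat_path last_rcons.
case/andP=> ab_ ba; rewrite size_cat /= => s'.
have : L <= (size c1).+1 \/ L <= (size c2).+1 by move: cL; rewrite s'; move: (size c1) (size c2); clear; lia.
have u'' : uniq (a :: c1 ++ b :: c2) by [].
case=> le_L.
  exists (rcons c1 b); rewrite last_rcons size_rcons; split=> //.
  apply/and3P; split=> //.
    by move: u''; rewrite -cat_rcons -cat_cons cat_uniq => /andP[].
  by apply/allP => v vc; rewrite inE -cat_rcons -cat_cons mem_cat vc.
have : upath [set v in a :: c1 ++ b :: c2] b (rcons c2 a).
  apply/and3P; split=> //.
    rewrite -rcons_cons rcons_uniq; move: u'; rewrite mem_cat cat_uniq.
    by case/andP=> /norP[_ ->] /and3P[].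
  apply/allP => v; rewrite -rcons_cons mem_rcons !inE mem_cat inE.
  by case/or3P=> ->; rewrite ?orbT.
case/(upath_rev) => q []; rewrite last_rcons size_rcons => aq qb sq.
by exists q; rewrite sq.
Qed.

(** All neighbours in [A] of the first vertex of a longest path lie on that path; the farthest one
    closes a cycle on at least [k.+1] vertices. *)
Lemma min_degree_long_linked L k (A : {set T}) : A != set0 ->
  (forall v, v \in A -> k <= #|[set u in A | e v u]|) -> 0 < k -> L.*2 <= k.+1 ->
  exists Q : {set T}, [/\ Q \subset A, 1 < #|Q| & long_linked L Q].
Proof.
case/set0Pn => x0 /longest_exists[x [p [/and3P[xp up Ap] pmax]]].
move=> Adeg k0 kL.
have Ax : x \in A by case/andP: Ap.
set N := [set u in A | e x u]; have Nk : k <= #|N| by apply: Adeg.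
have Np u : u \in N -> u \in p.
  rewrite inE => /andP[Au xu]; apply/negPn/negP => u_p.
  have ux : u != x by apply: contraTneq xu => ->; rewrite e_irr.
  suff /pmax : upath A u (x :: p) by rewrite /= ltnn.
  by rewrite /upath /= e_sym xu xp inE negb_or ux u_p -[_ && uniq p]/(uniq (x :: p)) up Au.
have [u0 Nu0] : exists u, u \in N by apply/card_gt0P; apply: leq_trans Nk.
case: (arg_maxnP (fun u => index u p) Nu0) => u Nu umax.
case/splitPr Ep: {-}p / (Np u Nu) => [p1 p2].
have iu : index u p = size p1.
  move: up; rewrite Ep /= cat_uniq /= negb_or => /and4P[_ _ /andP[/negPf up1 _] _].
  by rewrite index_cat up1 /= eqxx addn0.
have N1 v : v \in N -> v \in rcons p1 u.
  move=> Nv; have := umax v Nv; rewrite iu Ep -cat_rcons index_cat.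
  by case: ifP => //= _; rewrite size_rcons; clear; lia.
have k1 : k <= size (rcons p1 u).
  apply: leq_trans Nk (leq_trans _ (card_size _)).
  by apply/subset_leq_card/subsetP.
have uc : uniq (x :: rcons p1 u).
  by move: up; rewrite Ep -cat_rcons -cat_cons cat_uniq => /andP[].
exists [set v in x :: rcons p1 u]; split.
- apply/subsetP => v; rewrite inE => vc; apply: (allP Ap).
  by rewrite Ep -cat_rcons -cat_cons mem_cat vc.
- rewrite cardsE (card_uniqP uc) /=.
  by rewrite ltnS; apply: leq_trans k0 k1.
apply: cycle_long_linked => //; last exact: leq_trans kL _.
rewrite /= rcons_path last_rcons.
move: xp; rewrite Ep -cat_rcons cat_path => /andP[-> _] /=.
by have : u \in N by []; rewrite inE e_sym => /andP[].
Qed.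

(** * Separating a long-linked set from a longest path *)

(** König's theorem for matching number at most one, the two coordinates being the two sides of a
    bipartite graph; [u0] is the answer for an empty relation. *)
Lemma matching_free_star (U : Type) (rho : U -> U -> Prop) (u0 : U) :
  (forall q a q' b, rho q a -> rho q' b -> q <> q' -> a <> b -> False) ->
  exists v, forall q a, rho q a -> q = v \/ a = v.
Proof.
move=> no2; have [[q [a qa]]|no1] := pselect (exists q a, rho q a); last first.
  by exists u0 => q a qa; case: no1; exists q, a.
have [[q' [b [q'b qq']]]|allq] := pselect (exists q' b, rho q' b /\ q' <> q).
  have ab : b = a by apply: contrapT => ba; exact: no2 q'b qa qq' ba.
  exists a => q2 c q2c; have [->|ca] := pselect (c = a); first by right.
  have [q2q|q2q] := pselect (q2 = q); last by case: (no2 _ _ _ _ q2c qa).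
  by rewrite ab in q'b; case: (no2 _ _ _ _ q2c q'b) => //; rewrite q2q => /esym.
exists q => q2 c q2c; left; apply: contrapT => q2q.
by apply: allq; exists q2, c.
Qed.

(** Cut the path into at most [m] blocks of [s] consecutive vertices. The connections from a maximal
    long-linked set to one block form a star; the centres make up [R], and [Y] is the side of
    [Q]. *)
Lemma interval_separator L s m (W Q : {set T}) x p :
  longest W x p -> size p < m * s -> s <= L.+2 ->
  long_linked L Q -> Q \subset W -> (forall v, v \in Q -> v \notin x :: p) ->
  exists R Y : {set T}, [/\ #|R| <= m, Q :\: R \subset Y, Y \subset W,
    forall v, v \in Y -> v \notin x :: p &
    forall u v, u \in Y -> e u v -> v \in W -> v \notin R -> v \in Y].
Proof.
move=> xp pms sL QL QW Qp.
pose good (B : {set T}) :=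
  [/\ B \subset W, forall v, v \in B -> v \notin x :: p & long_linked L B].
have : `[< good Q >] by apply/asboolP.
case/(maxset_exists (P := fun B => `[< good B >])) => M maxM QM.
have [/asboolP[MW Mp ML] Mmax] := maxsetP maxM.
pose Z v := [&& v \in W, v \notin x :: p & v \notin M].
(* Only the interior of a connection is confined to [Z]; its end [v] may lie on the longest path or
   in [M]. *)
pose reach q v := exists r, path e q (rcons r v) /\ {subset r <= Z}.
have reach_uniq q a : q \in M -> a \in x :: p -> reach q a ->
    exists r, [/\ path e q (rcons r a), uniq r & {subset r <= Z}].
  move=> Mq pa [r [qr rZ]]; move: (last_rcons q r a).
  case/shortenP: qr => r' qr' ur' r'r; case/lastP: r' => [|r' z] in qr' ur' r'r *.
    by move=> /= qa; move: (Mp _ Mq); rewrite qa pa.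
  rewrite last_rcons => za; rewrite za in qr' ur' r'r.
  move: ur'; rewrite /= rcons_uniq => /and3P[_ ar' ur'].
  exists r'; split=> // v vr'; have := r'r v; rewrite !mem_rcons !inE vr' orbT.
  move=> /(_ isT)/orP[/eqP va|/rZ//]; by rewrite -va vr' in ar'.
have reach_lt q a q' b : q \in M -> q' \in M -> a \in x :: p -> b \in x :: p ->
    q != q' -> reach q a -> reach q' b ->
    index a (x :: p) < index b (x :: p) ->
    index a (x :: p) %/ s <> index b (x :: p) %/ s.
  move=> Mq Mq' pa pb qq' /(reach_uniq _ _ Mq pa)[r [qr ur rZ]].
  move=> /(reach_uniq _ _ Mq' pb)[r' [qr' ur' rZ']] lt_ab Eab.
  (* If the two connections met, following [r] to the first common vertex [z] and then [r'] back to
     [q'] would give an ear of [M], against maximality. *)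
  have dis : ~~ has [in r'] r.
    apply/negP => h; case: (split_find h) qr ur rZ => z r1 r2 zr' r1r' qr ur rZ.
    have [s1 [s2 Er']] : exists s1 s2, r' = s1 ++ z :: s2.
      by case/splitPr: zr' => s1 s2; exists s1, s2.
    have ear : path e q (rcons (rcons r1 z ++ rev s1) q').
      rewrite rcons_cat cat_path last_rcons -path_sym_rev.
      move: qr qr'; rewrite Er' !rcons_cat rcons_cons -cat_rcons !cat_path.
      by case/andP=> -> _ /andP[].
    have sub_ear : {subset rcons r1 z ++ rev s1 <= Z}.
      move=> v; rewrite mem_cat mem_rev => /orP[v1|v1].
        by apply: rZ; rewrite mem_cat v1.
      by apply: rZ'; rewrite Er' mem_cat v1.
    have u_ear : uniq (rcons r1 z ++ rev s1).
      rewrite cat_uniq rev_uniq has_rev.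
      move: ur ur'; rewrite Er' cat_uniq => /and3P[-> _ _].
      rewrite cat_uniq => /and3P[-> zs1 _] /=; rewrite andbT.
      apply/hasPn => v vs1; rewrite mem_rcons inE negb_or; apply/andP; split.
        apply: contraNneq zs1 => vz; apply/hasP; exists v => //.
        by rewrite vz mem_head.
      by apply: contra r1r' => vr1; apply/hasP; exists v; rewrite //= Er' mem_cat vs1.
    have out v : v \in rcons r1 z ++ rev s1 -> v \notin M.
      by move=> /sub_ear/and3P[].
    have EL := long_linked_ear ML Mq Mq' qq' ear u_ear out.
    have gM : `[< good (M :|: [set v in rcons r1 z ++ rev s1]) >].
      apply/asboolP; split=> //.
        rewrite subUset MW; apply/subsetP => v; rewrite inE.
        by move=> /sub_ear/and3P[].
      by move=> v; rewrite !inE => /orP[/Mp//|/sub_ear/and3P[]].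
    have := Mmax _ gM (subsetUl _ _) => EM.
    have : z \in M by rewrite -EM !inE mem_cat mem_rcons mem_head orbT.
    by apply/negP/out; rewrite mem_cat mem_rcons mem_head.
  have ab : a != b by apply: contraTneq lt_ab => ->; rewrite ltnn.
  have nZ v : v \in x :: p -> (v \in r = false) * (v \in r' = false).
    move=> vp; split; apply/negP; [move/rZ|move/rZ'] => /and3P[_];
    by rewrite vp.
  have [||f [fL fb fM ef uf]] := join_legs ML Mq Mq' qq' qr qr'.
  - rewrite cat_uniq !rcons_uniq (nZ a pa) ur (nZ b pb) ur' /= andbT.
    rewrite has_rcons !mem_rcons !inE eq_sym (negPf ab) (nZ b pb) /=.
    apply/hasPn => v vr'; rewrite mem_rcons inE negb_or.
    apply/andP; split; first by apply: contraTneq vr' => ->; rewrite (nZ a pa).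
    by apply: contra dis => vr; apply/hasP; exists v.
  - move=> v; rewrite mem_cat !mem_rcons !inE -orbA.
    case/or4P=> [/eqP->|/rZ/and3P[]//|/eqP->|/rZ'/and3P[]//].
      by apply/negP => /Mp; rewrite pa.
    by apply/negP => /Mp; rewrite pb.
  move: ef uf; rewrite rev_rcons -rcons_cat -rcons_cons -rcons_cat /= => ef.
  rewrite rcons_uniq => /and3P[_ _ uf].
  have := detour_short xp pa pb lt_ab ef uf.
  have fZ v : v \in rev r ++ q :: f ++ r' -> (v \in W) && (v \notin x :: p).
    rewrite mem_cat mem_rev inE mem_cat.
    have MWp w : w \in M -> (w \in W) && (w \notin x :: p).
      by move=> Mw; rewrite (subsetP MW _ Mw) Mp.
    case/or4P=> [/rZ/and3P[-> ->]//|/eqP->|/fM/MWp//|/rZ'/and3P[-> ->]//].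
    exact: MWp.
  move=> /(_ (fun v h => proj1 (andP (fZ v h))) (fun v h => proj2 (andP (fZ v h)))).
  (* The detour has at least [L.+1] inner vertices, so [a] and [b] are at least [L.+2] apart on the
     path; two vertices of one block are less than [s <= L.+2] apart. *)
  have -> : size (rev r ++ q :: f ++ r') = (size r + (size f + size r').+1)%N.
    by rewrite size_cat /= size_cat size_rev.
  have s0 : 0 < s by case: (s) pms => //; rewrite muln0.
  have Ea := divn_eq (index a (x :: p)) s; rewrite Eab in Ea.
  have Eb := divn_eq (index b (x :: p)) s.
  have lt_b := ltn_pmod (index b (x :: p)) s0.
  move: fL sL Ea Eb lt_b.
  move: (index b (x :: p) %/ s * s) (index a (x :: p) %% s) (index b (x :: p) %% s).
  move: (index a (x :: p)) (index b (x :: p)) (size r) (size r') (size f).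
  by clear; lia.
have reach_star (j : 'I_m) : exists v, forall q a,
    [/\ q \in M, a \in x :: p, reach q a & index a (x :: p) %/ s = j] ->
    q = v \/ a = v.
  apply: (matching_free_star x) => q a q' b [Mq pa qa ja] [Mq' pb qb jb].
  move=> /eqP qq' /eqP ab; have [lt|lt|Eab] := ltngtP (index a (x :: p)) (index b (x :: p)).
  - by apply: (reach_lt q a q' b); rewrite ?ja ?jb.
  - by apply: (reach_lt q' b q a); rewrite ?ja ?jb // eq_sym.
  by move: ab; rewrite -(nth_index x pa) Eab nth_index ?eqxx.
have [f fP] := fin_all_exists reach_star.
pose R := [set f j | j : 'I_m].
have hit q a : q \in M -> a \in x :: p -> reach q a -> (q \in R) || (a \in R).
  move=> Mq pa qa; have s0 : 0 < s by case: (s) pms => //; rewrite muln0.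
  have jm : index a (x :: p) %/ s < m.
    by rewrite ltn_divLR //; apply: leq_trans pms; move: pa; rewrite -index_mem.
  have fR : f (Ordinal jm) \in R by apply: imset_f.
  by case: (fP (Ordinal jm) q a) => [|->|->]; rewrite ?fR ?orbT.
(* [Y] collects, outside [R], the vertices of [M] and the vertices of [Z] reached from some vertex
   of [M] outside [R]. *)
exists R, [set v | `[< v \notin R /\ (v \in M \/
  Z v /\ exists q, [/\ q \in M, q \notin R & reach q v]) >]]; split.
- by rewrite (leq_trans (leq_imset_card _ _)) // card_ord.
- apply/subsetP => v; rewrite !inE => /andP[vR vQ]; apply/asboolP; split=> //.
  by left; apply: (subsetP QM).
- apply/subsetP => v; rewrite inE => /asboolP[_ [/(subsetP MW)//|[/andP[]//]]].
- by move=> v; rewrite inE => /asboolP[_ [/Mp//|[/and3P[]//]]].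
move=> u v; rewrite !inE => /asboolP[uR Yu] uv Wv vR; apply/asboolP; split=> //.
have [q [Mq qR quv]] : exists q, [/\ q \in M, q \notin R & reach q v].
  case: Yu => [Mu|[Zu [q [Mq qR [r [qr rZ]]]]]].
    by exists u; split=> //; exists [::]; rewrite /= uv.
  exists q; split=> //; exists (rcons r u); rewrite rcons_path last_rcons qr uv.
  by split=> // w; rewrite mem_rcons inE => /orP[/eqP->|/rZ].
have [|vM] := boolP (v \in M); [by left | right; split; last by exists q].
(* On the path, [v] would end a connection with neither end in [R], which [hit] excludes. *)
rewrite /Z Wv vM andbT; apply/negP => pv.
by move: (hit _ _ Mq pv quv); rewrite (negPf qR) (negPf vR).
Qed.

(** * Outer neighbourhoods and minimal fragments *)

Definition nbh (V X : {set T}) : {set T} :=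
  [set y in V :\: X | [exists x in X, e x y]].

Lemma long_linked_card L (Q : {set T}) : long_linked L Q -> 1 < #|Q| ->
  exists x p, upath Q x p /\ L <= size p.
Proof.
move=> QL /card_gt1P[x [y [Qx Qy xy]]].
by have [p [xp _ pL]] := QL x y Qx Qy xy; exists x, p.
Qed.

Lemma upath_size (A : {set T}) x p : upath A x p -> size p < #|A|.
Proof.
case/and3P=> _ up /allP Ap; rewrite -[_.+1]/(size (x :: p)) -(card_uniqP up).
exact/subset_leq_card/subsetP.
Qed.

Lemma nbhP (V X : {set T}) x y : x \in X -> e x y -> y \in V -> y \notin X ->
  y \in nbh V X.
Proof.
by move=> Xx xy Vy Xy; rewrite !inE Xy Vy; apply/existsP; exists x; rewrite Xx.
Qed.

(* The two sides A and B of a separation by R satisfy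
   |nbh A| + |nbh B| <= 2 |R| + |nbh X|, so both cannot exceed K. *)
Lemma minimal_fragment_short_links (V X Q : {set T}) K L s m x p :
  X \subset V -> #|nbh V X| <= K ->
  (forall Y : {set T}, Y != set0 -> Y \subset X -> #|nbh V Y| <= K -> Y = X) ->
  longest (X :|: nbh V X) x p -> size p < m * s -> s <= L.+2 ->
  m.*2 <= K.+1 -> K + m <= L ->
  Q \subset X -> (forall v, v \in Q -> v \notin x :: p) -> 1 < #|Q| ->
  long_linked L Q -> False.
Proof.
move=> XV NK Xmin xp pms sL mK KmL QX Qp Q1 QL.
set W := X :|: nbh V X in xp.
have QW : Q \subset W by apply: subset_trans QX (subsetUl _ _).
have WV : W \subset V.
  rewrite subUset XV; apply/subsetP => v; rewrite !inE.
  by case/andP=> /andP[].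
have [R [Y [Rm QY YW Yp Ycl]]] := interval_separator xp pms sL QL QW Qp.
have [y [q [yq qL]]] := long_linked_card QL Q1.
have qp : size q <= size p.
  by case: xp => _; apply; apply: upath_sub yq.
(* [Q] has more than [L >= m] vertices, so [R] cannot contain it. *)
have [a] : exists a, a \in X :&: Y.
  have : ~~ (Q \subset R).
    apply/negP => /subset_leq_card; rewrite leqNgt => /negP; apply.
    apply: leq_trans (leq_ltn_trans qL (upath_size yq)).
    by rewrite ltnS (leq_trans Rm) // (leq_trans _ KmL) // leq_addl.
  case/subsetPn => a Qa aR; exists a; rewrite inE (subsetP QX) //=.
  by apply: (subsetP QY); rewrite inE aR.
(* The longest path has more than [L >= K + m] vertices, so one of them avoids both [nbh V X] and
   [R]; it lies in [X], and [Y] misses the path. *)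
have [b] : exists b, b \in X :\: (Y :|: R).
  have : ~~ ([set v in x :: p] \subset nbh V X :|: R).
    apply/negP => /subset_leq_card; rewrite leqNgt => /negP; apply.
    case: xp => /and3P[_ up _] _.
    have -> : #|[set v in x :: p]| = (size p).+1 by rewrite cardsE (card_uniqP up).
    rewrite ltnS.
    apply: leq_trans (leq_trans KmL (leq_trans qL qp)).
    by apply: leq_trans (leq_card_setU _ _) (leq_add _ _).
  case/subsetPn => b; rewrite inE => pb; rewrite inE negb_or => /andP[bN bR].
  exists b; rewrite !inE (negPf bR) orbF; apply/andP; split.
    by apply: contraL pb => /Yp.
  case: xp => /and3P[_ _ /allP Wp] _; have := Wp _ pb.
  by rewrite inE (negPf bN) orbF.
set A := X :&: Y; set B := X :\: (Y :|: R) => Bb Aa.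
have BX : B \subset X by apply: subsetDl.
have AX : A \subset X by apply: subsetIl.
have bA : b \notin A.
  by move: Bb; rewrite !inE negb_or => /andP[/andP[/negPf-> _] ->].
have aB : a \notin B by move: Aa; rewrite !inE negb_or => /andP[-> ->].
have X_nbh (C : {set T}) u v : C \subset X -> u \in C -> e u v -> v \in V ->
    (v \in X) || (v \in nbh V X).
  move=> CX Cu uv Vv; have [//|Xv] := boolP (v \in X).
  exact: nbhP (subsetP CX _ Cu) uv Vv Xv.
have NA : nbh V A \subset R :|: (nbh V X :&: Y).
  apply/subsetP => v; rewrite [v \in nbh _ _]inE => /andP[/setDP[Vv Av]].
  case/existsP=> u /andP[Au uv]; rewrite inE; case: (boolP (v \in R)) => //= vR.
  have Wv := X_nbh _ _ _ AX Au uv Vv.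
  have Yv : v \in Y.
    apply: Ycl uv _ vR; first by move: Au; rewrite inE => /andP[].
    by rewrite inE.
  rewrite inE Yv andbT; case/orP: Wv => // Xv.
  by move: Av; rewrite inE Xv Yv.
have NB : nbh V B \subset R :|: (nbh V X :\: Y).
  apply/subsetP => v; rewrite [v \in nbh _ _]inE => /andP[/setDP[Vv Bv]].
  case/existsP=> u /andP[Bu uv]; rewrite inE; case: (boolP (v \in R)) => //= vR.
  have Wv := X_nbh _ _ _ BX Bu uv Vv.
  have Yv : v \notin Y.
    move: Bu; rewrite !inE negb_or => /andP[/andP[uY uR] Xu].
    apply: contra uY => Yv; apply: Ycl Yv _ _ uR; first by rewrite e_sym.
    by rewrite inE Xu.
  rewrite inE Yv /=; case/orP: Wv => // Xv.
  by move: Bv; rewrite !inE Xv (negPf Yv) (negPf vR).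
have KA : K < #|nbh V A|.
  rewrite ltnNge; apply/negP => /Xmin EA; move: bA; rewrite EA //.
    by rewrite (subsetP BX).
  by apply/set0Pn; exists a.
have KB : K < #|nbh V B|.
  rewrite ltnNge; apply/negP => /Xmin EB; move: aB; rewrite EB //.
    by rewrite (subsetP AX).
  by apply/set0Pn; exists b.
have lA := leq_trans (subset_leq_card NA) (leq_card_setU _ _).
have lB := leq_trans (subset_leq_card NB) (leq_card_setU _ _).
(* Summing up, [2 (K + 1) <= 2 |R| + |nbh V X| <= 2 m + K <= 2 K + 1], which is absurd. *)
have := cardsID Y (nbh V X).
move: KA KB lA lB NK Rm mK; rewrite -addnn.
move: #|nbh V A| #|nbh V B| #|nbh V X| #|R| #|nbh V X :&: Y| #|nbh V X :\: Y|.
by clear; lia.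
Qed.

End Paths.

(** * Edge counting and the decomposition into clusters *)

Lemma adj_sym (T : finType) (G : {set {set T}}) : symmetric (adj G).
Proof. by move=> x y; rewrite /adj setUC. Qed.

Lemma adj_irr (T : finType) (G : {set {set T}}) :
  simple_graph G -> irreflexive (adj G).
Proof.
by move=> sG x; apply/negP => /sG; rewrite setUid cards1.
Qed.

Definition edges_in (T : finType) (G : {set {set T}}) (A : {set T}) :
  {set {set T}} := [set f in G | f \subset A].

(** Degeneracy: without a long-linked subset every nonempty part of [A] has a vertex of degree below
    [k], and removing such vertices one by one counts the edges. *)
Lemma edges_in_sparse (T : finType) (G : {set {set T}}) k L (A : {set T}) :
  simple_graph G -> 0 < k -> L.*2 <= k.+1 ->
  (forall Q : {set T}, Q \subset A -> 1 < #|Q| -> long_linked (adj G) L Q -> False) ->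
  #|edges_in G A| <= k * #|A|.
Proof.
move=> sG k0 kL; have [n] := ubnP #|A|; elim: n A => // n IHn A /ltnSE leAn noQ.
have [->|A0] := eqVneq A set0.
  suff -> : edges_in G set0 = set0 by rewrite cards0.
  apply/setP => f; rewrite !inE subset0; apply/negP => /andP[/sG f2 /eqP f0].
  by rewrite f0 cards0 in f2.
have [v Av degv] : exists2 v, v \in A & #|[set u in A | adj G v u]| < k.
  have [/exists_inP//|] :=
    boolP [exists v in A, #|[set u in A | adj G v u]| < k].
  rewrite negb_exists_in => /forall_inP degA.
  have degA' v : v \in A -> k <= #|[set u in A | adj G v u]|.
    by move=> /degA; rewrite -leqNgt.
  have [Q [QA Q1 QL]] :=
    min_degree_long_linked (@adj_sym _ G) (adj_irr sG) A0 degA' k0 kL.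
  by case: (noQ Q QA Q1 QL).
have AvA : A :\ v \subset A by apply: subD1set.
have cA : #|A| = #|A :\ v|.+1 by rewrite (cardsD1 v) Av.
have IH : #|edges_in G (A :\ v)| <= k * #|A :\ v|.
  apply: IHn; first by rewrite -cA.
  by move=> Q QA; apply: noQ; apply: subset_trans AvA.
rewrite cA mulnS addnC; apply: leq_trans (leq_add IH (ltnW degv)).
apply: leq_trans (leq_add (leqnn _) (leq_imset_card (fun u => [set v; u]) _)).
apply: leq_trans (leq_card_setU _ _); apply/subset_leq_card/subsetP => f.
rewrite !inE => /andP[Gf fA]; rewrite Gf /= subsetD1 fA /=.
have [vf|//] := boolP (v \in f); have /eqP/cards2P[a [b [_ Ef]]] := sG f Gf.
have [u Ef'] : exists u, f = [set v; u].
  move: vf; rewrite Ef !inE => /orP[/eqP->|/eqP->]; first by exists b.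
  by exists a; rewrite setUC.
apply/imsetP; exists u => //; rewrite inE /adj -Ef' Gf andbT.
by apply: (subsetP fA); rewrite Ef' !inE eqxx orbT.
Qed.

Lemma no_path_upath (T : finType) (G : {set {set T}}) d (A : {set T}) x p :
  ~ has_path G d -> upath (adj G) A x p -> size p < d.
Proof.
move=> noP /and3P[xp up _]; rewrite ltnNge; apply/negP => dp; apply: noP.
exists x, (take d p); split; first by rewrite size_takel.
  by move: up; rewrite -{1}(cat_take_drop d p) -cat_cons cat_uniq => /andP[].
by move: xp; rewrite -{1}(cat_take_drop d p) cat_path => /andP[].
Qed.

(** Minimal fragments are peeled off by induction on [#|V|], each charging [K + k] deleted edges to
    each of its vertices. The labelling [lab] numbers the fragments, so that components need not be
    tracked during the induction. *)
Lemma clustering (T : finType) (G : {set {set T}}) d K k L s m :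
  simple_graph G -> ~ has_path G d -> 0 < k -> L.*2 <= k.+1 ->
  d <= m * s -> s <= L.+2 -> m.*2 <= K.+1 -> K + m <= L ->
  forall V : {set T}, exists (H : {set {set T}}) (lab : T -> nat),
  [/\ H \subset edges_in G V,
      #|edges_in G V :\: H| <= (K + k) * #|V|,
      forall f x y, f \in H -> x \in f -> y \in f -> lab x = lab y &
      forall c, exists S : {set T}, #|S| <= d /\
        forall f, f \in H -> (forall x, x \in f -> lab x = c) -> f :&: S != set0].
Proof.
move=> sG noP k0 kL dms sL mK KmL V.
have [n] := ubnP #|V|; elim: n V => // n IHn V /ltnSE leVn.
have [->|V0] := eqVneq V set0.
  exists set0, (fun=> 0); split; first exact: sub0set.
  - rewrite setD0 cards0 muln0 leqn0 cards_eq0; apply/eqP/setP => f.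
    rewrite !inE subset0; apply/negP => /andP[/sG f2 /eqP f0].
    by rewrite f0 cards0 in f2.
  - by move=> f x y; rewrite inE.
  - by move=> c; exists set0; rewrite cards0; split=> // f; rewrite inE.
pose e := adj G; pose N := nbh e V.
pose P (X : {set T}) := [&& X != set0, X \subset V & #|N X| <= K].
(* [V] itself has no outer neighbours in [V], so a minimal fragment exists. *)
have PV : P V.
  rewrite /P V0 subxx /=; suff -> : N V = set0 by rewrite cards0.
  by apply/setP => v; rewrite !inE; case: (v \in V).
have [X /minsetP[/and3P[X0 XV NK] Xmin] _] := minset_exists PV.
have [x [p xp]] : exists x p, longest e (X :|: N X) x p.
  by case/set0Pn: X0 => x0 Xx0; apply: (@longest_exists _ _ _ x0); rewrite inE Xx0.
have pd : size p < d by apply: no_path_upath noP (proj1 xp).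
pose S := [set v in x :: p].
have sparse : #|edges_in G (X :\: S)| <= k * #|X|.
  apply: leq_trans (leq_mul (leqnn k) (subset_leq_card (subsetDl X S))).
  apply: (edges_in_sparse sG k0 kL) => Q QXS Q1 QL.
  have QX : Q \subset X := subset_trans QXS (subsetDl _ _).
  apply: (minimal_fragment_short_links (@adj_sym _ G) XV NK _ xp _ sL mK KmL QX _ Q1 QL).
  - move=> Y Y0 YX YK; apply: Xmin => //.
    by rewrite /P Y0 (subset_trans YX XV).
  - exact: leq_trans pd dms.
  - by move=> v /(subsetP QXS); rewrite !inE => /andP[].
pose V' := V :\: X.
have cV : #|V| = (#|X| + #|V'|)%N by rewrite -(cardsID X V) (setIidPr XV).
have [|H' [lab' [H'V' H'G lab'H' cov']]] := IHn V'.
  apply: leq_trans leVn; rewrite cV -[X in X < _]add0n ltn_add2r.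
  by rewrite card_gt0.
have V'V : V' \subset V by apply: subsetDl.
(* An empty edge would carry every label vacuously, and so would have to be covered in every
   class. *)
have nonempty f : f \in G -> exists u, u \in f.
  by move=> /sG f2; apply/set0Pn; rewrite -card_gt0 f2.
have H'P f : f \in H' -> f \in G /\ f \subset V'.
  by move=> /(subsetP H'V'); rewrite inE => /andP[].
pose HX := [set f in edges_in G X | f :&: S != set0].
(* Label 0 goes to the new fragment; the earlier labels are shifted up. *)
pose lab v := if v \in X then 0 else (lab' v).+1.
have labX f v : f \in HX -> v \in f -> lab v = 0.
  by rewrite !inE => /andP[/andP[_ /subsetP fX] _] /fX; rewrite /lab => ->.
have labV' f v : f \in H' -> v \in f -> lab v = (lab' v).+1.
  move=> /H'P[_ /subsetP fV'] /fV'; rewrite inE /lab.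
  by case/andP=> /negPf->.
exists (HX :|: H'), lab; split.
- rewrite subUset; apply/andP; split; apply/subsetP => f.
    by rewrite !inE => /andP[/andP[-> /subset_trans->]].
  by case/H'P; rewrite inE => -> /subset_trans->.
(* A lost edge was lost in [V'], or lies in [X] and misses the path, or joins [X] to [N X]. *)
- have sub : edges_in G V :\: (HX :|: H') \subset
      (edges_in G V' :\: H') :|: (edges_in G (X :\: S) :|:
        [set [set u.1; u.2] | u in setX X (N X)]).
    apply/subsetP => f; rewrite [f \in _ :\: _]inE !inE negb_or.
    case/andP=> /andP[fHX ->] /andP[Gf fV]; rewrite Gf /=.
    have cross a b : f = [set a; b] -> a \in X -> b \notin X ->
        f \in [set [set u.1; u.2] | u in setX X (N X)].
      move=> Ef Xa Xb; apply/imsetP; exists (a, b) => //; rewrite inE /= Xa /=.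
      apply: nbhP Xa _ _ Xb; first by rewrite /e /adj -Ef.
      by apply: (subsetP fV); rewrite Ef !inE eqxx orbT.
    have /eqP/cards2P[a [b [_ Ef]]] := sG f Gf.
    have [Xa|Xa] := boolP (a \in X); have [Xb|Xb] := boolP (b \in X).
    + have fX : f \subset X by rewrite Ef subUset !sub1set Xa Xb.
      move: fHX; rewrite Gf fX /= negbK => /eqP fS.
      by rewrite subsetD fX -setI_eq0 fS eqxx orbT.
    + by rewrite (cross a b) ?orbT.
    + by rewrite (cross b a) ?orbT // Ef setUC.
    have -> // : f \subset V'.
    by rewrite subsetD fV Ef disjoints_subset subUset !sub1set !inE Xa Xb.
  apply: leq_trans (subset_leq_card sub) _.
  apply: leq_trans (leq_card_setU _ _) _.
  rewrite cV mulnDr addnC; apply: leq_add H'G.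
  apply: leq_trans (leq_card_setU _ _) _; rewrite mulnDl addnC.
  apply: leq_add sparse; apply: leq_trans (leq_imset_card _ _) _.
  by rewrite cardsX mulnC leq_mul2r NK orbT.
- move=> f u v; rewrite inE => /orP[fX|fH'] fu fv.
    by rewrite (labX f) // (labX f).
  by rewrite !(labV' f) // (lab'H' f u v).
case=> [|c].
  exists S; split.
    case: xp => /and3P[_ up _] _.
    have -> : #|S| = (size p).+1 by rewrite cardsE (card_uniqP up).
    by [].
  move=> f; rewrite inE => /orP[|fH' f0]; first by rewrite inE => /andP[].
  have [u fu] := nonempty f (proj1 (H'P f fH')).
  by move: (f0 u fu); rewrite (labV' f).
have [S' [S'd S'P]] := cov' c; exists S'; split=> // f.
rewrite inE => /orP[fX|fH'] fc.
  have [u fu] : exists u, u \in f.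
    by apply: nonempty; move: fX; rewrite !inE => /andP[/andP[]].
  by move: (fc u fu); rewrite (labX f).
by apply: S'P => // u fu; apply: succn_inj; rewrite -(labV' f) // fc.
Qed.

Lemma component_label (T : finType) (H : {set {set T}}) (lab : T -> nat) x y :
  (forall f u v, f \in H -> u \in f -> v \in f -> lab u = lab v) ->
  y \in component H x -> lab y = lab x.
Proof.
move=> labH; rewrite inE => /connectP[p xp ->].
elim: p x xp => //= z p IHp x /andP[xz /IHp->].
by apply: labH xz _ _; rewrite !inE eqxx ?orbT.
Qed.

(** * Choice of constants and conclusion *)

(** These are the constraints for [K = 4N], [m = 2N] and [s = L + 2]. The factor 12 makes
    [k >= 12 N], hence [L >= 6 N = K + m]. *)
Lemma parameters (N d : nat) : 0 < N -> 12 * N * N <= d ->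
  let k := d %/ N in let L := k./2 in
  [/\ 0 < k, L.*2 <= k.+1, d <= 2 * N * L.+2, 4 * N + 2 * N <= L &
      (4 * N + k) * N <= 2 * d].
Proof.
move=> N0 Nd k L.
have kN : 12 * N <= k by rewrite /k leq_divRL.
have dk : d < k.+1 * N by rewrite ltn_ceil.
have kd : k * N <= d by rewrite leq_trunc_div.
have kL := odd_double_half k; rewrite -/L -addnn in kL.
have k2 : k <= (L + L).+1 by rewrite -kL; case: (odd k); rewrite ?add0n ?add1n.
clear kL; rewrite -addnn; split; [lia|lia|nia|lia|nia].
Qed.

Import Order.TTheory GRing.Theory Num.Theory.
Local Open Scope ring_scope.

Theorem theorem1p4 (R : realType) (eps : R) (heps : 0 < eps) :
  exists C0 : R, forall C : R, C0 <= C ->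
  forall (d : nat), C <= d%:R ->
  forall (T : finType) (G : {set {set T}}),
    simple_graph G ->
    eps * d%:R * #|T|%:R <= #|G|%:R ->
    ~ has_path G d ->
    exists H : {set {set T}},
      [/\ H \subset G,
          #|G :\: H|%:R <= eps * #|G|%:R &
          forall x : T, exists S : {set T},
            is_cover H (component H x) S /\ #|S|%:R <= C * d%:R].
Proof.
(* Chosen so that [N * eps ^+ 2 >= 4]; the successor makes [N] positive. *)
pose N := (Num.bound (4 / eps ^+ 2)).+1.
have eps2 : 0 < eps ^+ 2 by rewrite exprn_gt0.
have Neps : 4 <= N%:R * eps ^+ 2.
  rewrite -ler_pdivrMr // ltW //; apply: lt_le_trans (archi_boundP _) _.
    by rewrite divr_ge0 // ltW.
  by rewrite ler_nat.
exists (12 * N * N)%N%:R => C C0C d Cd T G sG eG noP.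
have Nd : (12 * N * N <= d)%N by rewrite -(ler_nat R) (le_trans C0C).
have C1 : 1 <= C by apply: le_trans C0C; rewrite ler1n.
have [k0 kL dms KmL KkN] := parameters (ltn0Sn _ : 0 < N)%N Nd.
set k := (d %/ N)%N in k0 kL KmL dms KkN.
have [|H [lab [HG delH labH covH]]] :=
  @clustering T G d (4 * N) k k./2 k./2.+2 (2 * N) sG noP k0 kL dms
    (leqnn _) _ KmL setT.
  by rewrite -muln2; lia.
have edgesT : edges_in G setT = G.
  by apply/setP => f; rewrite inE subsetT andbT.
rewrite edgesT cardsT in HG delH.
exists H; split=> // [|x].
  (* From [(4N + k) N <= 2 d] and [N * eps ^+ 2 >= 4]. One factor [eps] is then spent on
     [eps * d * |T| <= e(G)], and the other remains in the bound on deleted edges. *)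
  have Kkd : (4 * N + k)%N%:R <= eps ^+ 2 * d%:R.
    have : ((4 * N + k)%N%:R * N%:R : R) <= 2 * d%:R.
      by rewrite -!natrM ler_nat.
    move: Neps; set a : R := (4 * N + k)%N%:R; set n : R := N%:R => Neps aN.
    have a0 : 0 <= a by rewrite ler0n.
    have d0 : 0 <= d%:R :> R by rewrite ler0n.
    have h1 : a * 4 <= a * (n * eps ^+ 2) by rewrite ler_wpM2l.
    have h2 : a * n * eps ^+ 2 <= 2 * d%:R * eps ^+ 2 by rewrite ler_wpM2r // ltW.
    have h3 : 0 <= d%:R * eps ^+ 2 by rewrite mulr_ge0 // ltW.
    by nra.
  apply: (@le_trans _ _ ((4 * N + k) * #|T|)%N%:R); first by rewrite ler_nat.
  rewrite natrM; apply: (@le_trans _ _ (eps ^+ 2 * d%:R * #|T|%:R)).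
    by rewrite ler_wpM2r.
  by rewrite expr2 -!mulrA ler_wpM2l ?(ltW heps) // mulrA.
have [S [Sd Scov]] := covH (lab x).
(* Labels are constant on components, so the cover of the label class of [x] covers its component;
   its order is at most [d <= C * d] as [C >= 1]. *)
exists (S :&: component H x); split.
  split=> [|f Hf fx]; first exact: subsetIr.
  rewrite setICA (setIidPl fx) setIC.
  by apply: Scov => // u /(subsetP fx) /(component_label labH).
apply: (@le_trans _ _ d%:R); last by rewrite ler_peMl.
by rewrite ler_nat (leq_trans (subset_leq_card (subsetIl _ _)) Sd).
Qed.
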